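(* Let $\mathcal{X}=(X_1,\dots,X_n)$ be a multiset family that is discrete and satisfies the inflation functional equation $\psi(\mathcal{X})=\mathcal{X}$. Then $\mathcal{X}$ uniquely partitions into a finite number of irreducible discrete multiset families that satisfy the same inflation functional equation; that is, there are finitely many irreducible discrete multiset families $\mathcal{X}^{(1)},\dots,\mathcal{X}^{(N)}$ with $\psi(\mathcal{X}^{(i)})=\mathcal{X}^{(i)}$ for each $i$ and $\mathcal{X}=\bigvee_{i=1}^N\mathcal{X}^{(i)}$, and this collection is unique up to reordering.
   Context: Fix integers $d,n\ge 1$, an expanding real $d\times d$ matrix $A$ (all eigenvalues, real or complex, have absolute value $>1$), and finite, possibly empty, sets $\mathcal{D}_{ij}\subset\mathbb{R}^d$ for $1\le i,j\le n$. A multiset $X$ in $\mathbb{R}^d$ is a set $\underline{X}\subset\mathbb{R}^d$ (the underlying set) with a multiplicity function $m_X:\underline{X}\to\mathbb{Z}_{>0}$, extended by $m_X(\mathbf{x})=0$ for $\mathbf{x}\notin\underline{X}$. $X\subseteq Y$ means $m_X\le m_Y$ everywhere. The multiset union $X\vee Y$ has multiplicity function $m_X+m_Y$. $A(X)$ has multiplicity $m_X(A^{-1}\mathbf{x})$ at $\mathbf{x}$, and $X+\mathcal{D}=\bigvee_{\mathbf{d}\in\mathcal{D}}(X+\mathbf{d})$. A multiset family (or $n$-multiset family) is a vector $\mathcal{X}=(X_1,\dots,X_n)$ of multisets in $\mathbb{R}^d$; union $\vee$ and inclusion $\subseteq$ are componentwise. It is nonempty if some $X_i$ is nonempty. It is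 discrete if, for each $i$, every bounded subset of $\mathbb{R}^d$ contains only finitely many points of $\underline{X_i}$ and all multiplicities are finite. The inflation operator is $\psi(\mathcal{X})=(X_1',\dots,X_n')$ with $X_i'=\bigvee_{j=1}^n(A(X_j)+\mathcal{D}_{ij})$, and the inflation functional equation is $\psi(\mathcal{X})=\mathcal{X}$. A nonempty multiset family $\mathcal{X}$ with $\psi(\mathcal{X})=\mathcal{X}$ is irreducible if there is no nonempty multiset family $\mathcal{X}'\subsetneq\mathcal{X}$ with $\psi(\mathcal{X}')=\mathcal{X}'$, where $\mathcal{X}'\subsetneq\mathcal{X}$ means $X_i'\subseteq X_i$ for all $i$ and $X_i'\ne X_i$ for some $i$. *)

(* Defs.v *)
From HB Require Import structures.
From mathcomp Require Import all_boot all_order all_algebra finmap.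
From mathcomp Require Import complex.
From mathcomp Require Import all_classical all_reals all_analysis.
Set Implicit Arguments.
Unset Strict Implicit.
Unset Printing Implicit Defensive.
Import Order.TTheory GRing.Theory Num.Theory numFieldNormedType.Exports.
Local Open Scope classical_set_scope.
Local Open Scope ring_scope.

Section MultisetFamilies.
Context (R : realType) (d n : nat).

(* The norm of R[i] is R[i]-valued and real, so the comparison below is the
   usual one between real numbers. *)
Definition expanding (A : 'M[R]_d) : Prop :=
  forall z : R[i], eigenvalue (map_mx (real_complex R) A) z -> 1 < `|z|.

(* A multiset is given by its multiplicity function, extended by 0 outside the
   underlying set; multiplicities are therefore always finite. *)
Definition multiset := 'cV[R]_d -> nat.

Definition underlying (X : multiset) : set 'cV[R]_d := [set x | (0 < X x)%N].

Definition msubset (X Y : multiset) : Prop := forall x, (X x <= Y x)%N.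

Definition mbigunion (I : Type) (r : seq I) (F : I -> multiset) : multiset :=
  fun x => (\sum_(k <- r) F k x)%N.

Definition mimage (A : 'M[R]_d) (X : multiset) : multiset :=
  fun x => X (invmx A *m x).

Definition mtranslate (X : multiset) (t : 'cV[R]_d) : multiset :=
  fun x => X (x - t).

Definition msumset (X : multiset) (D : {fset 'cV[R]_d}) : multiset :=
  mbigunion D (mtranslate X).

Definition mfamily := 'I_n -> multiset.

Definition fsubset (X Y : mfamily) : Prop := forall i, msubset (X i) (Y i).

Definition fpropersubset (X Y : mfamily) : Prop :=
  fsubset X Y /\ exists i, X i <> Y i.

Definition fbigunion (N : nat) (Y : 'I_N -> mfamily) : mfamily :=
  fun i => mbigunion (enum 'I_N) (fun k => Y k i).

Definition fnonempty (X : mfamily) : Prop := exists i, underlying (X i) !=set0.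

(* Bounded for the sup norm on 'cV[R]_d. *)
Definition fdiscrete (X : mfamily) : Prop :=
  forall i (B : set 'cV[R]_d), bounded_set B ->
    finite_set (B `&` underlying (X i)).

Definition inflation (A : 'M[R]_d) (D : 'I_n -> 'I_n -> {fset 'cV[R]_d})
    (X : mfamily) : mfamily :=
  fun i => mbigunion (enum 'I_n) (fun j => msumset (mimage A (X j)) (D i j)).

Definition irreducible (A : 'M[R]_d) (D : 'I_n -> 'I_n -> {fset 'cV[R]_d})
    (X : mfamily) : Prop :=
  [/\ fnonempty X, inflation A D X = X &
      ~ exists X' : mfamily,
          [/\ fnonempty X', fpropersubset X' X & inflation A D X' = X'] ].

Definition irreducible_partition (A : 'M[R]_d)
    (D : 'I_n -> 'I_n -> {fset 'cV[R]_d})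
    (X : mfamily) (N : nat) (Y : 'I_N -> mfamily) : Prop :=
  (forall k, [/\ irreducible A D (Y k), fdiscrete (Y k) &
                 inflation A D (Y k) = Y k]) /\
  X = fbigunion Y.

End MultisetFamilies.

(* Main.v *)
Require Import Defs.
From HB Require Import structures.
From mathcomp Require Import all_boot all_order all_algebra finmap.
From mathcomp Require Import complex.
From mathcomp Require Import all_classical all_reals all_analysis.
From mathcomp Require Import perm lra ring.
Import Order.TTheory GRing.Theory Num.Theory numFieldNormedType.Exports.
Local Open Scope classical_set_scope.
Local Open Scope ring_scope.

(** The families fixed by the inflation psi form a monoid under union, and the
    theorem is unique factorisation in that monoid: irreducible families are
    its atoms, X factors because a length function exists below X, and the
    factorisation is unique because atoms are prime.

    Factorisation.  Since A is expanding, there is a subadditive gauge N on R^d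
    for which the inverse of A is a strict contraction ([expanding_gauge]).  A
    point of a fixed family always has a predecessor A^-1 (x - t) in the family
    with t in a finite set ([fixed_predecessor]), so going backwards decreases
    N until one enters a fixed bounded region B.  Thus every nonempty fixed
    family meets the same B ([fixed_meets_bounded]).  By discreteness X has
    finitely many points in B, so counting the points of a family that lie in
    B, with multiplicity, gives every family below X a finite weight; it is
    additive, and positive on nonempty fixed families.  The
    difference of nested fixed families is fixed, so a reducible family splits
    into two fixed families of smaller weight, and induction on the weight
    ends ([irreducible_decomposition_exists]).

    Uniqueness.  If psi U <= U, the iterates of psi on U decrease, hence are
    eventually constant at each point, and their limit is the greatest fixed
    family below U ([greatest_fixed_below]).  Any two fixed families therefore
    have a greatest fixed lower bound; as fixed families can also be
    subtracted, the monoid is lattice-ordered, and there atoms are prime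
    ([irreducible_prime_fadd]).  Cancelling equal atoms one at a time shows
    that two factorisations agree up to order
    ([irreducible_decomposition_unique]). *)

Set Implicit Arguments.
Unset Strict Implicit.
Unset Printing Implicit Defensive.

(** * Eventually constant sequences and finite lists *)

(** Once the sequence has taken its least value, it stays there. *)
Lemma nat_nonincreasing_eventually_const (u : nat -> nat) :
  (forall m, u m.+1 <= u m)%N -> exists w, \forall m \near \oo, u m = w.
Proof.
move=> hu; have ex : exists v, `[< exists m, u m = v >].
  by exists (u 0%N); apply/asboolP; exists 0%N.
have {ex} [v /asboolP[m <-] vmin] := ex_minnP ex.
exists (u m), m => // k /= mk; apply/eqP; rewrite eqn_leq; apply/andP; split.
  by rewrite -(subnKC mk); elim: (k - m)%N => [|l IH];
    rewrite ?addn0// addnS (leq_trans (hu _)).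
by apply: vmin; apply/asboolP; exists k.
Qed.

Lemma near_eq_sum (I : Type) (r : seq I) (u : nat -> I -> nat) (w : I -> nat) :
  (forall k, \forall m \near \oo, u m k = w k) ->
  \forall m \near \oo, (\sum_(k <- r) u m k = \sum_(k <- r) w k)%N.
Proof.
move=> h; elim: r => [|k r IH]; first by near=> m; rewrite !big_nil.
near=> m; rewrite !big_cons; congr addn; near: m; [exact: h|exact: IH].
Unshelve. all: by end_near. Qed.

(** M is the maximum of 0 and the entries of s; the last clause turns strict
    bounds on the entries into a uniform one. *)
Lemma bigmax_seq_ub (R : realType) (s : seq R) :
  exists M, [/\ 0 <= M, forall a, a \in s -> a <= M &
    forall b, 0 < b -> (forall a, a \in s -> a < b) -> M < b].
Proof.
elim: s => [|a s [M [M0 sM Mlt]]]; first by exists 0.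
exists (Num.max a M); split.
- by rewrite le_max M0 orbT.
- by move=> b; rewrite in_cons le_max => /orP[/eqP ->|/sM ->]; rewrite ?lexx ?orbT.
- move=> b b0 sb; rewrite gt_max sb ?mem_head// Mlt// => e es.
  by apply: sb; rewrite in_cons es orbT.
Qed.

Lemma perm_eq_bijection (T : eqType) M N (Z : 'I_M -> T) (Y : 'I_N -> T) :
  perm_eq [seq Z k | k <- enum 'I_M] [seq Y k | k <- enum 'I_N] ->
  exists f : 'I_M -> 'I_N, bijective f /\ forall k, Z k = Y (f k).
Proof.
move=> ZY; have MN : M = N.
  by have := perm_size ZY; rewrite size_map size_enum_ord size_map size_enum_ord.
case: N / MN Y ZY => Y /(@tuple_permP _ _ _ (mktuple Y))[p pE].
exists (p : _ -> _); split; first exact: injF_bij perm_inj.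
have /(congr1 (fun t => tnth t _)) tE :
    mktuple Z = [tuple tnth (mktuple Y) (p i) | i < M] by apply: val_inj.
by move=> k; have := tE k; rewrite !tnth_mktuple.
Qed.

(** * The monoid of fixed families *)

Section Families.
Context (R : realType) (d n : nat).
Local Notation fsubset := Defs.fsubset.
Implicit Types (X Y Z W U : mfamily R d n) (s t : seq (mfamily R d n)).

Definition fadd X Y : mfamily R d n := fun i x => (X i x + Y i x)%N.
Definition fsub X Y : mfamily R d n := fun i x => (X i x - Y i x)%N.
Definition fmin X Y : mfamily R d n := fun i x => minn (X i x) (Y i x).
Definition fsum s : mfamily R d n := fun i x => (\sum_(Z <- s) Z i x)%N.

Lemma fadd_subK X Y : fsubset Y X -> fadd Y (fsub X Y) = X.
Proof. by move=> h; apply/funext => i; apply/funext => x; exact: subnKC (h i x). Qed.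

Lemma fadd_inj X Y Z : fadd X Y = fadd X Z -> Y = Z.
Proof.
move=> h; apply/funext => i; apply/funext => x.
exact: addnI (congr1 (fun W : mfamily R d n => W i x) h).
Qed.

Lemma fsub_subset X Y : fsubset (fsub X Y) X.
Proof. by move=> i x; apply: leq_subr. Qed.

Lemma fsubset_trans X Y Z : fsubset X Y -> fsubset Y Z -> fsubset X Z.
Proof. by move=> h1 h2 i x; apply: leq_trans (h1 i x) (h2 i x). Qed.

Lemma fsubset_anti X Y : fsubset X Y -> fsubset Y X -> X = Y.
Proof.
move=> h1 h2; apply/funext => i; apply/funext => x.
by apply/eqP; rewrite eqn_leq; apply/andP; split; [exact: h1|exact: h2].
Qed.

Lemma fsubset_fmin X Y Z : fsubset Z X -> fsubset Z Y -> fsubset Z (fmin X Y).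
Proof.
by move=> h1 h2 i x; rewrite leq_min; apply/andP; split; [exact: h1|exact: h2].
Qed.

Lemma fmin_subsetl X Y : fsubset (fmin X Y) X.
Proof. by move=> i x; apply: geq_minl. Qed.

Lemma fmin_subsetr X Y : fsubset (fmin X Y) Y.
Proof. by move=> i x; apply: geq_minr. Qed.

Lemma fsum_nil : fsum [::] = fun _ _ => 0%N.
Proof. by apply/funext => i; apply/funext => x; rewrite /fsum big_nil. Qed.

Lemma fsum_cons Z s : fsum (Z :: s) = fadd Z (fsum s).
Proof. by apply/funext => i; apply/funext => x; rewrite /fsum big_cons. Qed.

Lemma fsum_cat s t : fsum (s ++ t) = fadd (fsum s) (fsum t).
Proof. by apply/funext => i; apply/funext => x; rewrite /fsum big_cat. Qed.

Lemma perm_fsum s t : perm_eq s t -> fsum s = fsum t.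
Proof. by move=> st; apply/funext => i; apply/funext => x; apply: perm_big. Qed.

Lemma fbigunion_fsum N (Y : 'I_N -> mfamily R d n) :
  fbigunion Y = fsum [seq Y k | k <- enum 'I_N].
Proof.
by apply/funext => i; apply/funext => x; rewrite /fsum big_map.
Qed.

Lemma fsubset_fsum Z s : Z \in s -> fsubset Z (fsum s).
Proof. by move=> Zs i x; rewrite /fsum (big_rem Z)//= leq_addr. Qed.

Lemma fnonemptyP X : fnonempty X <-> X <> fun _ _ => 0%N.
Proof.
split=> [[i [x Xx]] X0|X0]; first by move: Xx; rewrite /underlying X0.
apply: contrapT => /forallNP h; apply: X0; apply/funext => i; apply/funext => x.
by apply/eqP; rewrite -leqn0 leqNgt; apply/negP => Xx; apply: (h i); exists x.
Qed.

Lemma fdiscrete_subset X Y : fsubset X Y -> fdiscrete Y -> fdiscrete X.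
Proof.
move=> XY Yd i B Bb; apply: sub_finite_set (Yd i B Bb) => x [Bx Xx].
by split=> //; apply: leq_trans Xx (XY i x).
Qed.

Variables (A : 'M[R]_d) (D : 'I_n -> 'I_n -> {fset 'cV[R]_d}).
Local Notation psi := (inflation A D).

Lemma inflationE X i x : psi X i x =
  (\sum_(j <- enum 'I_n) \sum_(t <- D i j) X j (invmx A *m (x - t)))%N.
Proof. by []. Qed.

Lemma inflationD X Y : psi (fadd X Y) = fadd (psi X) (psi Y).
Proof.
apply/funext => i; apply/funext => x; rewrite /fadd !inflationE -big_split /=.
by apply: eq_bigr => j _; rewrite -big_split.
Qed.

Lemma inflation_mono X Y : fsubset X Y -> fsubset (psi X) (psi Y).
Proof. by move=> h i x; apply: leq_sum => j _; apply: leq_sum => t _; apply: h. Qed.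

Lemma fixed_fadd X Y : psi X = X -> psi Y = Y -> psi (fadd X Y) = fadd X Y.
Proof. by rewrite inflationD => -> ->. Qed.

(** Additivity of psi and cancellation. *)
Lemma fixed_fsub X Y :
  fsubset Y X -> psi X = X -> psi Y = Y -> psi (fsub X Y) = fsub X Y.
Proof.
move=> YX hX hY; apply: (@fadd_inj Y); rewrite -{1}hY -inflationD.
by rewrite !fadd_subK.
Qed.

Lemma fixed_fsum s : (forall Z, Z \in s -> psi Z = Z) -> psi (fsum s) = fsum s.
Proof.
elim: s => [|Z s IH] h.
  apply/funext => i; apply/funext => x.
  by rewrite fsum_nil inflationE big1// => j _; rewrite big1.
rewrite fsum_cons; apply: fixed_fadd; first by apply: h; rewrite mem_head.
by apply: IH => W Ws; apply: h; rewrite in_cons Ws orbT.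
Qed.

Lemma fixed_predecessor X i x : psi X = X -> underlying (X i) x ->
  exists j, exists2 t, t \in D i j & underlying (X j) (invmx A *m (x - t)).
Proof.
move=> hX; rewrite /underlying/= -{1}hX inflationE => Xx; apply: contrapT => h.
move: Xx; rewrite big1 // => j _; rewrite big_seq big1 // => t tD.
by apply/eqP; rewrite -leqn0 leqNgt; apply/negP => Xt; apply: h; exists j, t.
Qed.

Lemma irreducible_minimal Y W : irreducible A D Y -> psi W = W -> fsubset W Y ->
  fnonempty W -> W = Y.
Proof.
move=> [_ _ h] hW WY W0; apply: contrapT => nWY; apply: h; exists W; split=> //.
by split=> //; apply: contrapT => /forallNP h; apply: nWY; apply/funext => i;
  apply: contrapT; apply: h.
Qed.

(** W is the pointwise limit of the iterates of psi on U: they decrease, and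
    since a value of psi is a finite sum of values, psi commutes with this
    eventually stationary limit.  Monotonicity keeps every fixed family below
    U under all iterates. *)
Lemma greatest_fixed_below U : fsubset (psi U) U -> exists W,
  [/\ psi W = W, fsubset W U &
      forall V, psi V = V -> fsubset V U -> fsubset V W].
Proof.
move=> hU; pose u m := iter m psi U.
have dec m : fsubset (u m.+1) (u m).
  by elim: m => [//|m IH] /=; apply: inflation_mono.
have /choice[W hW] : forall p : 'I_n * 'cV[R]_d,
    exists w, \forall m \near \oo, u m p.1 p.2 = w.
  by move=> p; apply: nat_nonincreasing_eventually_const => m; apply: dec.
exists (fun i x => W (i, x)); split.
- apply/funext => i; apply/funext => x; rewrite inflationE.
  have h1 : \forall m \near \oo, u m.+1 i x =
     (\sum_(j <- enum 'I_n) \sum_(t <- D i j) W (j, invmx A *m (x - t)%R))%N.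
    apply: (@near_eq_sum _ _
      (fun m j => \sum_(t <- D i j) u m j (invmx A *m (x - t)%R))%N) => j.
    have hj (t : 'cV[R]_d) : \forall m \near \oo,
      u m j (invmx A *m (x - t)) = W (j, invmx A *m (x - t)) := hW (j, _).
    exact: near_eq_sum hj.
  have h2 : \forall m \near \oo, u m.+1 i x = W (i, x).
    have [M _ hM] := hW (i, x); exists M => // m /= Mm.
    exact: (hM m.+1 (leq_trans Mm (leqnSn m))).
  near \oo => m; transitivity (u m.+1 i x); last by near: m.
  by apply: esym; near: m.
- move=> i x; near \oo => m.
  have <- : u m i x = W (i, x) by near: m; apply: hW (i, x).
  have uU k : fsubset (u k) U.
    by elim: k => [i' x'|k IH]; [exact: leqnn|apply: fsubset_trans (dec k) IH].
  exact: uU.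
- move=> V hV VU i x; near \oo => m.
  have <- : u m i x = W (i, x) by near: m; apply: hW (i, x).
  have Vu k : fsubset V (u k).
    by elim: k => [//|k IH]; rewrite -hV; apply: inflation_mono.
  exact: Vu.
Unshelve. all: by end_near. Qed.

(** Let W be the greatest fixed family below both Z1 + Z2 and Y + Z2.  It
    contains Y and Z2, and W - Z2 is a fixed family below both atoms Z1 and Y.
    If W - Z2 is nonempty, it equals both; if it is empty, Y <= W = Z2. *)
Lemma irreducible_prime_fadd Y Z1 Z2 :
  irreducible A D Y -> irreducible A D Z1 -> psi Z2 = Z2 ->
  fsubset Y (fadd Z1 Z2) -> Y = Z1 \/ fsubset Y Z2.
Proof.
move=> Yirr Z1irr hZ2 YZ.
have [_ hY _] := Yirr; have [_ hZ1 _] := Z1irr.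
have [|W [hW WU Wmax]] := @greatest_fixed_below (fmin (fadd Z1 Z2) (fadd Y Z2)).
  apply: fsubset_fmin.
    rewrite -[X in fsubset _ X](fixed_fadd hZ1 hZ2).
    exact/inflation_mono/fmin_subsetl.
  rewrite -[X in fsubset _ X](fixed_fadd hY hZ2).
  exact/inflation_mono/fmin_subsetr.
have YW : fsubset Y W.
  by apply: Wmax => //; apply: fsubset_fmin => // i x; apply: leq_addr.
have Z2W : fsubset Z2 W.
  by apply: Wmax => //; apply: fsubset_fmin => i x; apply: leq_addl.
have hV := fixed_fsub Z2W hW hZ2.
have VZ1 : fsubset (fsub W Z2) Z1.
  by move=> i x; rewrite leq_subLR addnC; exact: (fsubset_trans WU (@fmin_subsetl _ _)).
have VY : fsubset (fsub W Z2) Y.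
  by move=> i x; rewrite leq_subLR addnC; exact: (fsubset_trans WU (@fmin_subsetr _ _)).
have [V0|V0] := pselect (fnonempty (fsub W Z2)).
  left; rewrite -(irreducible_minimal Yirr hV VY V0).
  exact: irreducible_minimal.
right; move: V0 => /fnonemptyP/contrapT V0.
by rewrite -(fadd_subK Z2W) V0 in YW => i x; have := YW i x; rewrite /fadd addn0.
Qed.

Lemma irreducible_mem_fsum Y s :
  irreducible A D Y -> (forall Z, Z \in s -> irreducible A D Z) ->
  fsubset Y (fsum s) -> Y \in s.
Proof.
move=> Yirr; elim: s => [_|Z s IH hs].
  rewrite fsum_nil => Y0; have [/fnonemptyP[]] := Yirr.
  by apply/fsubset_anti => // i x.
rewrite fsum_cons in_cons.
have hs' W : W \in s -> irreducible A D W.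
  by move=> Ws; apply: hs; rewrite in_cons Ws orbT.
move=> /irreducible_prime_fadd[]//.
- by apply: hs; rewrite mem_head.
- by apply: fixed_fsum => W /hs'[].
- by move=> ->; rewrite eqxx.
- by move=> /(IH hs') ->; rewrite orbT.
Qed.

(** The head of s is prime, hence occurs in t; removing it from both lists
    leaves equal sums by cancellation. *)
Lemma irreducible_decomposition_unique s t :
  (forall Z, Z \in s -> irreducible A D Z) ->
  (forall Z, Z \in t -> irreducible A D Z) ->
  fsum s = fsum t -> perm_eq s t.
Proof.
elim: s t => [|Y s IH] t hs ht.
  case: t ht => [//|Z t] ht st; have [] := ht Z (mem_head _ _).
  move=> /fnonemptyP[]; apply: fsubset_anti => [|i x//].
  by rewrite -fsum_nil st; apply: fsubset_fsum; rewrite mem_head.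
move=> st; have Yt : Y \in t.
  apply: irreducible_mem_fsum => //; first by apply: hs; rewrite mem_head.
  by rewrite -st; apply: fsubset_fsum; rewrite mem_head.
have tE := perm_to_rem Yt; rewrite (permPr tE) perm_cons.
apply: IH.
- by move=> Z Zs; apply: hs; rewrite in_cons Zs orbT.
- by move=> Z /mem_rem; apply: ht.
by apply: (@fadd_inj Y); rewrite -!fsum_cons st; apply: perm_fsum.
Qed.

(** Well-foundedness enters only through the additive weight mu: a reducible
    family is the union of two nonempty fixed ones, each of strictly smaller
    weight because the other has positive weight. *)
Lemma irreducible_decomposition_exists (mu : mfamily R d n -> nat) X :
  {morph mu : Y Z / fadd Y Z >-> (Y + Z)%N} ->
  (forall Z, psi Z = Z -> fsubset Z X -> fnonempty Z -> (0 < mu Z)%N) ->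
  psi X = X ->
  exists2 s, (forall Z, Z \in s -> irreducible A D Z) & X = fsum s.
Proof.
move=> muD mu_gt0 hX.
suff H m Z : (mu Z < m)%N -> psi Z = Z -> fsubset Z X ->
    exists2 s, (forall Z, Z \in s -> irreducible A D Z) & Z = fsum s.
  by apply: (H (mu X).+1) => // i x; apply: leqnn.
elim: m Z => [//|m IH] Z muZ hZ ZX.
have [Z0|Z0] := pselect (fnonempty Z); last first.
  by exists [::] => //; rewrite fsum_nil; apply: contrapT => /fnonemptyP.
have [Zirr|Zred] := pselect (irreducible A D Z).
  exists [:: Z]; first by move=> W; rewrite inE => /eqP ->.
  by apply/funext => i; apply/funext => x; rewrite /fsum big_seq1.
have [Y [Y0 [YZ [i nYZ]] hY]] : exists Y,
    [/\ fnonempty Y, fpropersubset Y Z & psi Y = Y].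
  by apply: contrapT => h; apply: Zred.
have hV := fixed_fsub YZ hZ hY.
have V0 : fnonempty (fsub Z Y).
  apply/fnonemptyP => V0; apply: nYZ; rewrite -(fadd_subK YZ) V0.
  by apply/funext => x; rewrite /fadd addn0.
have VX := fsubset_trans (@fsub_subset Z Y) ZX.
have YX := fsubset_trans YZ ZX.
have muE : mu Z = (mu Y + mu (fsub Z Y))%N by rewrite -muD fadd_subK.
have Ypos := mu_gt0 _ hY YX Y0; have Vpos := mu_gt0 _ hV VX V0.
rewrite muE ltnS in muZ.
have [|s hs sE] := IH Y _ hY YX.
  by apply: leq_trans muZ; rewrite -addn1 leq_add2l.
have [|t ht tE] := IH (fsub Z Y) _ hV VX.
  by apply: leq_trans muZ; rewrite -add1n leq_add2r.
exists (s ++ t); last by rewrite fsum_cat -sE -tE fadd_subK.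
by move=> W; rewrite mem_cat => /orP[/hs|/ht].
Qed.

End Families.

(** * A gauge contracted by the inverse of an expanding matrix *)

Section Gauge.
Context (R : realType).
Local Notation C := R[i].
Local Notation normc := (@Normc.normc R).
Import ComplexField.

Lemma normE (z : C) : `|z| = (normc z)%:C%C.
Proof. by case: z => a b; rewrite normc_def. Qed.

Lemma normc_ge0 (z : C) : 0 <= normc z.
Proof. by case: z => a b; apply: sqrtr_ge0. Qed.

Lemma normcD (x y : C) : normc (x + y) <= normc x + normc y.
Proof. exact: le_normcD. Qed.

(** The complex modulus is taken in its real-valued form, so that all estimates
    are between real numbers. *)
Definition l1norm (d : nat) (v : 'cV[C]_d) : R := \sum_i normc (v i 0).

Lemma l1norm_ge0 d (v : 'cV[C]_d) : 0 <= l1norm v.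
Proof. by apply: sumr_ge0 => i _; apply: normc_ge0. Qed.

Lemma l1normD d (v w : 'cV[C]_d) : l1norm (v + w) <= l1norm v + l1norm w.
Proof.
by rewrite /l1norm -big_split; apply: ler_sum => i _; rewrite mxE; apply: normcD.
Qed.

Lemma l1normZ d (a : C) (v : 'cV[C]_d) : l1norm (a *: v) = normc a * l1norm v.
Proof. by rewrite /l1norm mulr_sumr; apply: eq_bigr => i _; rewrite mxE Normc.normcM. Qed.

Lemma normc_le_l1norm (d : nat) (v : 'cV[C]_d) i : normc (v i 0) <= l1norm v.
Proof.
by rewrite /l1norm (bigD1 i)//= lerDl sumr_ge0// => j _; apply: normc_ge0.
Qed.

Context (d : nat) (B : 'M[C]_d.+1).

(** With v_0 = x and v_(k+1) = (B - a_k) v_k along the list s, this is the sum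
    of c^k |v_k|.  When s lists the eigenvalues of B, it is an adapted norm: it
    plays the part of a norm rescaled along a triangular form of B, with no
    change of basis. *)
Fixpoint gauge (c : R) (s : seq C) (x : 'cV[C]_d.+1) : R :=
  if s is a :: s' then l1norm x + c * gauge c s' (B *m x - a *: x) else 0.

Lemma gauge_ge0 c s x : 0 <= c -> 0 <= gauge c s x.
Proof.
by move=> c0; elim: s x => //= a s IH x; rewrite addr_ge0 ?l1norm_ge0// mulr_ge0.
Qed.

Lemma gaugeD c s x y : 0 <= c -> gauge c s (x + y) <= gauge c s x + gauge c s y.
Proof.
move=> c0; elim: s x y => [|a s IH] x y /=; first by rewrite addr0.
rewrite addrACA lerD ?l1normD// -mulrDr ler_wpM2l//.
by apply: le_trans (IH _ _); rewrite mulmxDr scalerDr opprD addrACA.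
Qed.

(** As B v_k = a_k v_k + v_(k+1), applying B multiplies the weight c^k of |v_k|
    by at most |a_k| + 1/c, which the second hypothesis bounds by r; the last
    hypothesis makes the chain v_k end in 0.  The summand |x| is what makes the
    induction go through, since the term |v_(k+1)| produced at stage k is
    absorbed at stage k + 1. *)
Lemma gauge_contract c (r : R) s x : 0 <= c ->
  (forall a, a \in s -> 1 + c * normc a <= r * c) ->
  horner_mx B (\prod_(a <- s) ('X - a%:P)) *m x = 0 ->
  l1norm x + c * gauge c s (B *m x) <= r * c * gauge c s x.
Proof.
move=> c0; elim: s x => [|a s IH] x hs /=.
  rewrite big_nil rmorph1 mul1mx => ->; rewrite !mulr0 addr0.
  by rewrite /l1norm big1// => i _; rewrite mxE Normc.normc0.
set y := B *m x - a *: x => hx.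
have {}hx : horner_mx B (\prod_(a <- s) ('X - a%:P)) *m y = 0.
  move: hx; rewrite big_cons mulrC rmorphM /= -mulmxA => <-; congr (_ *m _).
  by rewrite rmorphB /= horner_mx_X horner_mx_C mulmxBl mul_scalar_mx.
have By : B *m (B *m x) - a *: (B *m x) = B *m y.
  by rewrite /y mulmxBr -scalemxAr.
have xy : l1norm (B *m x) <= normc a * l1norm x + l1norm y.
  by rewrite -l1normZ; apply: le_trans (l1normD _ _); rewrite /y addrC subrK.
have hy := IH _ (fun b bs => hs b (mem_behead (s := a :: s) bs)) hx.
have ha := hs a (mem_head _ _); rewrite By.
have := ler_wpM2l (l1norm_ge0 x) ha.
have := ler_wpM2l c0 xy.
have := ler_wpM2l c0 hy.
lra.
Qed.
End Gauge.

Section Expanding.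
Import ComplexField.
Context (R : realType).

Lemma expanding_unitmx d (A : 'M[R]_d) : expanding A -> A \in unitmx.
Proof.
move=> hA; rewrite -(map_unitmx (real_complex R)) -row_free_unit -kermx_eq0.
apply/negPn/negP => h; have := hA 0; rewrite normr0 ltr10.
by rewrite /eigenvalue /eigenspace raddf0 subr0 => /(_ h).
Qed.

Lemma eigenvalue_inv_expanding d (A : 'M[R]_d) (a : R[i]) : expanding A ->
  eigenvalue (map_mx (real_complex R) (invmx A)) a -> Normc.normc a < 1.
Proof.
move=> hA; have Au := expanding_unitmx hA; set Ac := map_mx (real_complex R) A.
have Acu : Ac \in unitmx by rewrite map_unitmx.
rewrite map_invmx -/Ac => /eigenvalueP[v vB v0].
have vE : v = a *: (v *m Ac) by rewrite scalemxAl -vB mulmxKV.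
have a0 : a != 0 by apply: contra_neq v0 => a0; rewrite vE a0 scale0r.
have : eigenvalue Ac a^-1.
  by apply/eigenvalueP; exists v => //; rewrite {2}vE scalerA mulVf// scale1r.
move=> /hA; rewrite normfV normE -(invr1) ltf_pV2 ?posrE ?ltr01//.
  by rewrite -[1]/(1%:C%C) ltcR.
by rewrite -normE normr_gt0.
Qed.

(** The eigenvalues a of the complexified inverse B of A have modulus at most
    some r < 1, and the product of the factors B - a vanishes by
    Cayley-Hamilton, so the gauge built on them is contracted once c is large. *)
Lemma expanding_gauge d (A : 'M[R]_d) : (1 <= d)%N -> expanding A ->
  exists (N : 'cV[R]_d -> R) (r : R),
  [/\ 0 <= r < 1, forall x y, N (x + y) <= N x + N y,
      forall (x : 'cV[R]_d) i, `|x i 0| <= N x &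
      forall x, N (invmx A *m x) <= r * N x].
Proof.
case: d A => [//|d] A _ hA; set B := map_mx (real_complex R) (invmx A).
have [s sE] := closed_field_poly_normal (char_poly B).
rewrite (eqP (char_poly_monic B)) scale1r in sE.
have s1 a : a \in s -> Normc.normc a < 1.
  move=> as_; apply: (eigenvalue_inv_expanding hA).
  by rewrite eigenvalue_root_char sE root_prod_XsubC.
have [r [r0 sr /(_ 1 ltr01) r1]] := bigmax_seq_ub [seq Normc.normc a | a <- s].
have {}r1 : r < 1 by apply: r1 => _ /mapP[a /s1 ? ->].
have r1' : 0 < 1 - r by rewrite subr_gt0.
have {}sr a : a \in s -> Normc.normc a <= r by move=> as_; apply/sr/map_f.
(* c solves 1 + c r = (1 + r)/2 * c, for a contraction ratio halfway from r
   to 1. *)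
pose c := 2 / (1 - r).
have c0 : 0 < c by rewrite divr_gt0.
have cE : 1 + c * r = (1 + r) / 2 * c by rewrite /c; field; rewrite gt_eqF.
exists (fun x => gauge B c s (map_mx (real_complex R) x)), ((1 + r) / 2); split.
- by apply/andP; split; lra.
- by move=> x y; rewrite map_mxD; apply: gaugeD; apply: ltW.
- move=> x i; case: s sE {s1 sr} => [|a s _ /=].
    by move=> /(congr1 (fun p : {poly _} => size p)); rewrite size_char_poly big_nil size_poly1.
  apply: (@le_trans _ _ (l1norm (map_mx (real_complex R) x))).
    apply: le_trans (normc_le_l1norm _ i).
    by rewrite mxE -lecR -normE normc_def /= expr0n addr0 sqrtr_sqr.
  by rewrite lerDl mulr_ge0 ?gauge_ge0 ?ltW.
- move=> x; rewrite map_mxM -/B; set y := map_mx _ x.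
  have : l1norm y + c * gauge B c s (B *m y) <= (1 + r) / 2 * c * gauge B c s y.
    apply: gauge_contract; first exact: ltW.
      by move=> a /sr ar; rewrite -cE lerD2l ler_wpM2l// ltW.
    by rewrite -sE Cayley_Hamilton mul0mx.
  move=> h; rewrite -(ler_pM2l c0) mulrCA [leRHS]mulrA; apply: le_trans h.
  by rewrite lerDr l1norm_ge0.
Qed.

End Expanding.

(** * Fixed families recur in a bounded region *)

Section Recurrence.
Context (R : realType) (d n : nat) (A : 'M[R]_d).
Context (D : 'I_n -> 'I_n -> {fset 'cV[R]_d}).
Local Notation psi := (inflation A D).
Local Notation fsubset := Defs.fsubset.

(** Going to a predecessor replaces N x by at most r (N x + T), where T bounds N
    on the opposites of all the digits.  Above the level K this is a loss of at
    least 1 - r, so finitely many steps lead below K. *)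
Lemma fixed_meets_bounded : (1 <= d)%N -> expanding A ->
  exists2 B : set 'cV[R]_d, bounded_set B &
    forall Z, psi Z = Z -> fnonempty Z ->
      exists i, B `&` underlying (Z i) !=set0.
Proof.
move=> d1 hA; have [N [r [/andP[r0 r1] ND Nge Nr]]] := expanding_gauge d1 hA.
have N0 x : 0 <= N x by apply: le_trans (Nge x (Ordinal d1)).
have [T [T0 hT _]] := bigmax_seq_ub
  [seq N (- t) | ij <- enum {: 'I_n * 'I_n}, t <- D ij.1 ij.2].
have {}hT i j t : t \in D i j -> N (- t) <= T.
  move=> tD; apply: hT; apply/allpairsPdep; exists (i, j), t.
  by split=> //; rewrite mem_enum.
have r1' : 0 < 1 - r by rewrite subr_gt0.
(* r T / (1 - r) solves N = r (N + T); the added 1 gives the uniform loss. *)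
pose K := r * T / (1 - r) + 1.
have K0 : 0 <= K by rewrite addr_ge0// divr_ge0 ?mulr_ge0// ltW.
have KE : (1 - r) * K = r * T + (1 - r) by rewrite /K; field; rewrite gt_eqF.
exists [set x | N x <= K].
  exists K; split; first exact: num_real.
  move=> M KM x /= xK; rewrite /Num.Def.normr /= mx_normrE.
  apply: bigmax_le => [|[i j] _ /=]; first exact: le_trans K0 (ltW KM).
  by rewrite ord1 (le_trans (Nge _ _))// (le_trans xK)// ltW.
move=> Z hZ [i [x Zx]].
have [m hm] : exists m : nat, N x <= K + m%:R * (1 - r).
  exists (Num.bound (N x / (1 - r))).
  have := archi_boundP (divr_ge0 (N0 x) (ltW r1')).
  by rewrite ltr_pdivrMr// => /ltW h; apply: le_trans h _; rewrite lerDr.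
elim: m i x Zx hm => [|m IH] i x Zx hm.
  by exists i, x; split=> //=; rewrite mul0r addr0 in hm.
have [xK|Kx] := leP (N x) K; first by exists i, x.
have [j [t tD Zy]] := fixed_predecessor hZ Zx.
apply: IH Zy _.
have := Nr (x - t); have := ler_wpM2l r0 (ND x (- t)).
have := ler_wpM2l r0 (hT _ _ _ tD).
have : (1 - r) * K <= (1 - r) * N x by rewrite ler_wpM2l ?ltW.
move: hm; rewrite KE -natr1; lra.
Qed.

(** The points of X in B index the sum, so that Z ranges over one fixed finite
    set and additivity in Z is immediate. *)
Definition window_mass (B : set 'cV[R]_d) (X Z : mfamily R d n) : nat :=
  (\sum_i \sum_(x <- fset_set (B `&` underlying (X i))) Z i x)%N.

Lemma window_massD B X : {morph window_mass B X : Y Z / fadd Y Z >-> (Y + Z)%N}.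
Proof.
move=> Y Z; rewrite /window_mass -big_split; apply: eq_bigr => i _.
by rewrite -big_split.
Qed.

Lemma window_mass_gt0 (B : set 'cV[R]_d) X Z : bounded_set B -> fdiscrete X ->
  fsubset Z X -> (exists i, B `&` underlying (Z i) !=set0) ->
  (0 < window_mass B X Z)%N.
Proof.
move=> Bb Xd ZX [i [x [Bx Zx]]]; rewrite /window_mass (bigD1 i)//= addn_gt0.
rewrite (big_rem x) /= ?addn_gt0; first by rewrite (Zx : (0 < Z i x)%N).
rewrite in_fset_set; last exact: Xd.
by rewrite inE; split=> //; apply: leq_trans Zx (ZX i x).
Qed.

End Recurrence.

(** * Unique decomposition *)

Theorem theorem2p1 (R : realType) (d n : nat) (hd : (1 <= d)%N) (hn : (1 <= n)%N)
    (A : 'M[R]_d) (hA : expanding A) (D : 'I_n -> 'I_n -> {fset 'cV[R]_d})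
    (X : mfamily R d n) (hdisc : fdiscrete X) (hX : inflation A D X = X) :
  exists (N : nat) (Y : 'I_N -> mfamily R d n),
    irreducible_partition A D X Y /\
    forall (M : nat) (Z : 'I_M -> mfamily R d n),
      irreducible_partition A D X Z ->
      exists f : 'I_M -> 'I_N, bijective f /\ forall k, Z k = Y (f k).
Proof.
have [B Bb hB] := fixed_meets_bounded D hd hA.
have [s sirr sE] : exists2 s : seq (mfamily R d n),
    (forall Z, Z \in s -> irreducible A D Z) & X = fsum s.
  apply: (irreducible_decomposition_exists (window_massD B X)) => // Z hZ ZX Z0.
  by apply: window_mass_gt0 => //; apply: hB.
exists (size s), (tnth (in_tuple s)); split.
  split; last by rewrite fbigunion_fsum map_tnth_enum.
  move=> k; have ks := mem_tnth k (in_tuple s); have irr := sirr _ ks.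
  split=> //; last by case: irr.
  apply: fdiscrete_subset hdisc; rewrite sE; exact: fsubset_fsum.
move=> M Z [Zirr ZE].
apply: perm_eq_bijection; rewrite map_tnth_enum.
apply: (@irreducible_decomposition_unique _ _ _ A D) => //.
  by move=> W /mapP[k _ ->]; case: (Zirr k).
by rewrite -[in_tuple s : seq _]/s -sE ZE fbigunion_fsum.
Qed.
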